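(* For $k\ge0$ let $M_k(x,z)=\sum_{n\ge0}\sum_{\pi\in\mathfrak{S}_n(132,12\cdots(k+1))}x^{\mathrm{fp}(\pi)}z^n$, and set $M_{-1}(x,z):=0$. For $0\le\ell\le k$ define $g_{k,\ell}(n)$ by $\sum_{n\ge0}g_{k,\ell}(n)z^n=\frac{U_\ell(\frac{1}{2z})}{z\,U_{k+1}(\frac{1}{2z})}$ and $G_{k,\ell}(z)=\sum_{n\ge0}g_{k,\ell}(n)^2z^n$, where the $U_m$ are the Chebyshev polynomials of the second kind, $U_0(t)=1$, $U_1(t)=2t$, $U_r(t)=2tU_{r-1}(t)-U_{r-2}(t)$. Then for every $k\ge0$, $$M_k(x,z)=\sum_{\ell=0}^kG_{k,\ell}(z)\bigl(1+(x-1)zM_{\ell-1}(x,z)\bigr).$$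
   Context: For permutations $\pi=\pi_1\cdots\pi_n\in\mathfrak{S}_n$ and $\sigma\in\mathfrak{S}_m$, $\pi$ contains $\sigma$ if there are indices $i_1<\dots<i_m$ such that $\pi_{i_1}\cdots\pi_{i_m}$ is in the same relative order as $\sigma$; otherwise $\pi$ avoids $\sigma$. $\mathfrak{S}_n(132,12\cdots(k+1))$ is the set of permutations in $\mathfrak{S}_n$ avoiding both $132$ and the increasing pattern $12\cdots(k+1)$. $\mathrm{fp}(\pi)=|\{i:\pi_i=i\}|$. *)

(* Defs.v *)
From HB Require Import structures.
From mathcomp Require Import all_boot all_order all_algebra all_fingroup.
From mathcomp Require Import boolp classical_sets.

Set Implicit Arguments.
Unset Strict Implicit.
Unset Printing Implicit Defensive.

Import GRing.Theory.
Local Open Scope ring_scope.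

(* Formal power series, with the Cauchy product. They form an integral domain
   over an integral domain, so that {fraction {fps F}} is the field of formal
   Laurent series over the field F. *)

Record fps (R : Type) := Fps { fps_coef : nat -> R }.
Arguments fps_coef {R} _ _.

Notation "{ 'fps' R }" := (fps R) (at level 0, format "{ 'fps'  R }").

Lemma fpsP (R : Type) (f g : {fps R}) : fps_coef f =1 fps_coef g <-> f = g.
Proof.
split=> [|->//]; case: f g => [f] [g] /= fg.
by congr Fps; apply: funext.
Qed.

HB.instance Definition _ (R : Type) := gen_eqMixin {fps R}.
HB.instance Definition _ (R : Type) := gen_choiceMixin {fps R}.

Section FpsRing.
Variable R : comNzRingType.
Implicit Types f g h : {fps R}.

Definition fps0 : {fps R} := Fps (fun=> 0).
Definition fps_opp f : {fps R} := Fps (fun n => - fps_coef f n).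
Definition fps_add f g : {fps R} := Fps (fun n => fps_coef f n + fps_coef g n).

Definition fpsC (c : R) : {fps R} := Fps (fun n => c *+ (n == 0)).
Definition fpsX : {fps R} := Fps (fun n => (n == 1)%:R).

Definition fps_mul f g : {fps R} :=
  Fps (fun n => \sum_(i < n.+1) fps_coef f i * fps_coef g (n - i)%N).

Fact fps_addA : associative fps_add.
Proof. by move=> f g h; apply/fpsP => n /=; rewrite addrA. Qed.
Fact fps_addC : commutative fps_add.
Proof. by move=> f g; apply/fpsP => n /=; rewrite addrC. Qed.
Fact fps_add0 : left_id fps0 fps_add.
Proof. by move=> f; apply/fpsP => n /=; rewrite add0r. Qed.
Fact fps_addN : left_inverse fps0 fps_opp fps_add.
Proof. by move=> f; apply/fpsP => n /=; rewrite addNr. Qed.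

HB.instance Definition _ :=
  GRing.isZmodule.Build {fps R} fps_addA fps_addC fps_add0 fps_addN.

(* The product only involves the truncations of its factors, so its laws can
   be inherited from {poly R}. *)
Let trunc N f : {poly R} := \poly_(i < N) fps_coef f i.

Let trunc_mul N f g n : (n < N)%N ->
  fps_coef (fps_mul f g) n = (trunc N f * trunc N g)`_n.
Proof.
move=> ltnN; rewrite coefM /=; apply: eq_bigr => i _.
have lein : (i <= n)%N by rewrite -ltnS.
rewrite !coef_poly (leq_ltn_trans lein ltnN).
by rewrite (leq_ltn_trans (leq_subr i n) ltnN).
Qed.

Let trunc_mull N f g (p : {poly R}) n : (n < N)%N ->
  (trunc N (fps_mul f g) * p)`_n = (trunc N f * trunc N g * p)`_n.
Proof.
move=> ltnN; rewrite !coefM; apply: eq_bigr => i _; congr (_ * _).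
have ltiN : (i < N)%N by apply: leq_ltn_trans ltnN; rewrite -ltnS.
by rewrite coef_poly ltiN (trunc_mul _ _ ltiN).
Qed.

Fact fps_mulC : commutative fps_mul.
Proof. by move=> f g; apply/fpsP => n; rewrite !(@trunc_mul n.+1) // mulrC. Qed.

Fact fps_mulA : associative fps_mul.
Proof.
move=> f g h; apply/fpsP => n; rewrite [in LHS]fps_mulC.
rewrite !(@trunc_mul n.+1) // !(@trunc_mull n.+1) //.
by rewrite mulrC mulrA.
Qed.

Fact fps_mul1 : left_id (fpsC 1) fps_mul.
Proof.
move=> f; apply/fpsP => n /=; rewrite big_ord_recl /= mul1r subn0 big1 ?addr0 //.
by move=> i _; rewrite mulr0n mul0r.
Qed.

Fact fps_mulDl : left_distributive fps_mul fps_add.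
Proof.
move=> f g h; apply/fpsP => n /=; rewrite -big_split.
by apply: eq_bigr => i _ /=; rewrite mulrDl.
Qed.

Fact fps1_neq0 : fpsC 1 != 0.
Proof.
by apply/eqP => /fpsP /(_ 0%N) /= /eqP; rewrite mulr1n oner_eq0.
Qed.

HB.instance Definition _ := GRing.Zmodule_isComNzRing.Build {fps R}
  fps_mulA fps_mulC fps_mul1 fps_mulDl fps1_neq0.

Lemma fps_coefD f g n : fps_coef (f + g) n = fps_coef f n + fps_coef g n.
Proof. by []. Qed.
Lemma fps_coefN f n : fps_coef (- f) n = - fps_coef f n.
Proof. by []. Qed.
Lemma fps_coefB f g n : fps_coef (f - g) n = fps_coef f n - fps_coef g n.
Proof. by []. Qed.
Lemma fps_coef0 n : fps_coef (0 : {fps R}) n = 0.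
Proof. by []. Qed.
Lemma fps_coef1 n : fps_coef (1 : {fps R}) n = (n == 0)%:R.
Proof. by []. Qed.
Lemma fps_coefM f g n :
  fps_coef (f * g) n = \sum_(i < n.+1) fps_coef f i * fps_coef g (n - i)%N.
Proof. by []. Qed.
Lemma fps_coef_sum (I : Type) (r : seq I) (P : pred I) (F : I -> {fps R}) n :
  fps_coef (\sum_(i <- r | P i) F i) n
  = \sum_(i <- r | P i) fps_coef (F i) n.
Proof. exact: (big_morph (fps_coef^~ n)). Qed.

Lemma fps_coefM0 f g : fps_coef (f * g) 0 = fps_coef f 0 * fps_coef g 0.
Proof. by rewrite fps_coefM big_ord1. Qed.

Lemma fps_coefX_lt f n i :
  fps_coef f 0 = 0 -> (n < i)%N -> fps_coef (f ^+ i) n = 0.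
Proof.
move=> f0; elim: i n => // i IHi n ltni; rewrite exprS fps_coefM big1 // => j _.
case: (posnP j) => [-> | j_gt0]; first by rewrite f0 mul0r.
rewrite ltnS in ltni; rewrite IHi ?mulr0 //; apply: leq_trans ltni.
rewrite ltn_subrL j_gt0 /=; apply: leq_trans j_gt0 _.
by rewrite -ltnS.
Qed.

End FpsRing.

Section FpsUnit.
Variable R : comUnitRingType.
Implicit Types f g : {fps R}.

Definition fps_unit : pred {fps R} := fun f => fps_coef f 0 \is a GRing.unit.

(* 1 / f = f_0^-1 (1 + h + h^2 + ...) where f = f_0 (1 - h) *)
Definition fps_inv f : {fps R} :=
  if fps_unit f then
    let a := (fps_coef f 0)^-1 in let h := 1 - fpsC a * f in
    fpsC a * Fps (fun n => \sum_(i < n.+1) fps_coef (h ^+ i) n)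
  else f.

Fact fps_mulVx : {in fps_unit, left_inverse 1 fps_inv *%R}.
Proof.
move=> f; rewrite -topredE /= => uf; rewrite /fps_inv uf /=.
set a := _^-1; set h := 1 - _; set s := Fps _.
have h0 : fps_coef h 0 = 0.
  by rewrite fps_coefB fps_coefM0 fps_coef1 /= mulr1n mulVr ?subrr.
rewrite mulrAC; have -> : fpsC a * f = 1 - h by rewrite opprB addrC subrK.
apply/fpsP => n.
have sE m : (m <= n)%N -> fps_coef s m = fps_coef (\sum_(i < n.+1) h ^+ i) m.
  move=> lemn; rewrite fps_coef_sum /= -(subnKC lemn) -addSn big_split_ord /=.
  rewrite [X in _ + X]big1 ?addr0 // => i _.
  by rewrite fps_coefX_lt // addSn ltnS leq_addr.
transitivity (fps_coef ((1 - h) * \sum_(i < n.+1) h ^+ i) n).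
  by rewrite !fps_coefM; apply: eq_bigr => i _; rewrite sE ?leq_subr.
rewrite -opprB mulNr -subrX1 opprB fps_coefB.
by rewrite fps_coefX_lt // subr0.
Qed.

Fact fps_unitPl f g : g * f = 1 -> fps_unit f.
Proof.
move=> /fpsP /(_ 0%N); rewrite fps_coefM0 fps_coef1 /= => gf1.
by apply/unitrPr; exists (fps_coef g 0); rewrite mulrC.
Qed.

Fact fps_inv_out : {in [predC fps_unit], fps_inv =1 id}.
Proof. by move=> f; rewrite inE /= /fps_inv -topredE => /negbTE /= ->. Qed.

HB.instance Definition _ := GRing.ComNzRing_hasMulInverse.Build {fps R}
  fps_mulVx fps_unitPl fps_inv_out.

End FpsUnit.

Section FpsIdomain.
Variable R : idomainType.

Fact fps_mulf_eq0 (f g : {fps R}) : f * g = 0 -> (f == 0) || (g == 0).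
Proof.
have low (u : {fps R}) : u != 0 ->
    exists2 m, fps_coef u m != 0 & forall i, (i < m)%N -> fps_coef u i = 0.
  move=> u0; have ex_m : exists m, fps_coef u m != 0.
    apply: contrapT => nex_m; case/eqP: u0; apply/fpsP => m; apply/eqP.
    by apply/negPn/negP => um; apply: nex_m; exists m.
  case: (ex_minnP ex_m) => m um min_m; exists m => // i ltim.
  by apply/eqP; apply: contraTT ltim => /min_m; rewrite -leqNgt.
move=> fg0; case: eqVneq => //= /low[m fm ltm]; apply: contraT => /low[n gn ltn_].
have /eqP : fps_coef (f * g) (m + n)%N = 0 by rewrite fg0.
rewrite fps_coefM.
have ltmS : (m < (m + n).+1)%N by rewrite ltnS leq_addr.
rewrite (bigD1 (Ordinal ltmS)) //= addKn big1 ?addr0 => [|i].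
  by rewrite mulf_eq0 (negbTE fm) (negbTE gn).
rewrite -val_eqE /= neq_ltn => /orP[/ltm-> | ltmi]; first by rewrite mul0r.
rewrite ltn_ ?mulr0 // ltn_subLR; first by rewrite ltn_add2r.
by rewrite -ltnS ltn_ord.
Qed.

HB.instance Definition _ :=
  GRing.ComUnitRing_isIntegral.Build {fps R} fps_mulf_eq0.

End FpsIdomain.

(* Pattern avoidance. Permutations of 'I_n act on 0, ..., n - 1, so positions
   and values are shifted by one with respect to one-line notation;
   132 becomes 0, 2, 1. *)

Definition contains n m (pi : 'S_n) (sigma : 'S_m) : bool :=
  [exists i : {ffun 'I_m -> 'I_n},
     [forall a : 'I_m, forall b : 'I_m,
        ((a < b)%N ==> (i a < i b)%N) &&
        ((pi (i a) < pi (i b))%N == (sigma a < sigma b)%N)]].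

Definition avoids n m (pi : 'S_n) (sigma : 'S_m) : bool :=
  ~~ contains pi sigma.

Definition pat132 : 'S_3 := tperm (inord 1) (inord 2).

Definition pat_incr m : 'S_m := 1%g.

Definition fp n (pi : 'S_n) : nat := #|[pred i : 'I_n | pi i == i]|.

(* M k lives in Q[x][[z]]: 'X is x and the series variable is z. The index is an
   integer in order to allow M (-1) = 0; indices below -1 are not used. *)
Definition M (k : int) : {fps {poly rat}} :=
  match k with
  | Posz k => Fps (fun n =>
      \sum_(pi : 'S_n | avoids pi pat132 && avoids pi (pat_incr k.+1))
         'X^(fp pi))
  | Negz _ => 0
  end.

Fixpoint chebU (m : nat) : {poly int} :=
  match m with
  | 0 => 1
  | 1 => 2 *: 'X
  | (m'.+1 as r).+1 => 2 *: 'X * chebU r - chebU m'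
  end.

Notation laurent := {fraction {fps rat}}.

Definition zL : laurent := tofrac (fpsX rat).

Definition chebU_inv2z (m : nat) : laurent :=
  (map_poly intr (chebU m)).[(2 * zL)^-1].

Definition g_laurent (k l : nat) : laurent :=
  chebU_inv2z l / (zL * chebU_inv2z k.+1).

(* The coefficients of the power series equal to g_laurent k l; this series
   exists for l <= k by g_gf below, and is unique since tofrac is injective. *)
Definition g (k l n : nat) : rat :=
  fps_coef (xget 0 [set f : {fps rat} | tofrac f = g_laurent k l]%classic) n.

Definition G (k l : nat) : {fps {poly rat}} :=
  Fps (fun n => (g k l n ^+ 2)%:P).

Section GeneratingFunction.

Let W := fix W (r : nat) : {fps rat} :=
  match r with
  | 0 | 1 => 1
  | (r'.+1 as s).+1 => W s - fpsX rat ^+ 2 * W r'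
  end.

Let WSS r : W r.+2 = W r.+1 - fpsX rat ^+ 2 * W r. Proof. by []. Qed.

Let W0 r : fps_coef (W r) 0 = 1 /\ fps_coef (W r.+1) 0 = 1.
Proof.
elim: r => [//|r [IH0 IH1]]; split=> //.
by rewrite WSS fps_coefB IH1 exprS -mulrA fps_coefM0 mul0r subr0.
Qed.

Let zL_neq0 : zL != 0.
Proof.
by rewrite tofrac_eq0; apply/eqP => /fpsP /(_ 1%N) /=.
Qed.

Let two_neq0 : (2 : laurent) != 0.
Proof.
rewrite -(rmorph_nat (@tofrac {fps rat})) tofrac_eq0.
by apply/eqP => /fpsP /(_ 0%N).
Qed.

Let chebU_W r :
  zL ^+ r * chebU_inv2z r = tofrac (W r) /\
  zL ^+ r.+1 * chebU_inv2z r.+1 = tofrac (W r.+1).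
Proof.
have zK : 2 * (2 * zL)^-1 * zL = 1.
  by rewrite invfM mulrA mulfV // mul1r mulVf.
elim: r => [|r [IH0 IH1]].
  rewrite /chebU_inv2z /= rmorph1 hornerC expr0 mul1r rmorph1; split=> //.
  by rewrite linearZ /= map_polyX hornerZ hornerX mulrC rmorph_nat zK.
split=> //; rewrite WSS tofracB tofracM tofracXn -IH0 -IH1 -/zL.
rewrite /chebU_inv2z.
have -> : chebU r.+2 = 2 *: 'X * chebU r.+1 - chebU r by [].
move: (chebU r.+1) (chebU r) => p q; rewrite rmorphB rmorphM /= map_polyZ.
rewrite map_polyX hornerD hornerN hornerM hornerZ hornerX rmorph_nat.
set u := (map_poly _ p).[_]; set v := (map_poly _ q).[_].
rewrite mulrBr; congr (_ - _); last by rewrite mulrA -exprD.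
rewrite [zL ^+ r.+2]exprSr -!mulrA; congr (_ * _).
by rewrite mulrCA [zL * _]mulrCA !mulrA zK mul1r.
Qed.

Lemma g_gf k l : (l <= k)%N -> tofrac (Fps (g k l)) = g_laurent k l.
Proof.
move=> lelk; rewrite /g; set f := xget _ _.
have -> : Fps [eta fps_coef f] = f by apply/fpsP.
suff ex : exists f : {fps rat}, tofrac f = g_laurent k l.
  exact: (@xgetPex _ 0 [set f : {fps rat} | tofrac f = g_laurent k l]%classic).
have uW : W k.+1 \is a GRing.unit.
  by rewrite -topredE /= /fps_unit (W0 k).2 unitr1.
exists (fpsX rat ^+ (k - l) * W l / W k.+1).
have WF : tofrac (W k.+1) != 0.
  by rewrite tofrac_eq0; apply: contraTneq uW => ->; rewrite unitr0.
apply: (mulIf WF); rewrite -tofracM mulrVK // tofracM tofracXn -/zL.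
rewrite -(chebU_W l).1 -(chebU_W k).2 mulrA -exprD subnK // /g_laurent.
have Uk : chebU_inv2z k.+1 != 0.
  by apply: contraNneq WF; rewrite -(chebU_W k).2 => ->; rewrite mulr0.
by rewrite exprSr -[zL ^+ k * zL * _]mulrA [RHS]mulrCA divfK // mulf_neq0.
Qed.

End GeneratingFunction.

(* Main.v *)
Require Import Defs.
From mathcomp Require Import all_boot all_order all_algebra all_fingroup.
From mathcomp Require Import zify boolp.

Set Implicit Arguments.
Unset Strict Implicit.
Unset Printing Implicit Defensive.

Import GRing.Theory.

(* Expand x^fp as the sum of (x - 1)^|S| over the sets S of fixed points. A fixed
   point i of a 132-avoiding permutation has below and to its left a block
   preserved by the permutation, and the j points above and to its right increase.
   The remaining points above i, and the inverse of those to the right of i, form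
   two 132-avoiding permutations with j increasing last entries, independent of
   each other and of the block. When i is the largest element of S, the rest of S
   lies in the block, which accounts for M_{l-1} with l = k - j. When S is empty, the same decomposition holds with an empty block
   and no i. The permutations with an increasing tail satisfy the recurrence of
   the paths in a strip of height k, as do the g_{k,k-j}; hence the squares. *)

(** * Permutations as injections of the natural numbers, and increasing tails *)

(** Extending by the identity lets a permutation in ['S_s] act on a longer interval whose additional
    points it fixes. *)
Definition permn n (s : 'S_n) (x : nat) : nat :=
  if insub x is Some i then val (s i) else x.

Lemma permn_ord n (s : 'S_n) (i : 'I_n) : permn s i = s i.
Proof. by rewrite /permn valK. Qed.

Lemma permnE n (s : 'S_n) x (xn : x < n) : permn s x = s (Ordinal xn).
Proof. by rewrite -permn_ord. Qed.

Lemma permn_out n (s : 'S_n) x : n <= x -> permn s x = x.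
Proof. by move=> h; rewrite /permn insubF // ltnNge h. Qed.

Lemma permn_lt n (s : 'S_n) x : (permn s x < n) = (x < n).
Proof.
case: (ltnP x n) => h; last by rewrite permn_out // ltnNge h.
by rewrite (permnE s h) ltn_ord.
Qed.

Lemma permnK n (s : 'S_n) : cancel (permn s) (permn s^-1%g).
Proof.
move=> x; case: (ltnP x n) => h; last by rewrite !permn_out.
by rewrite (permnE s h) permn_ord permK.
Qed.

Lemma permnKV n (s : 'S_n) : cancel (permn s^-1%g) (permn s).
Proof. by move=> x; rewrite -{1}(invgK s) permnK. Qed.

Lemma permn_inj n (s : 'S_n) : injective (permn s).
Proof. exact: can_inj (permnK s). Qed.

Lemma eq_permn n (s t : 'S_n) :
  (forall x, x < n -> permn s x = permn t x) -> s = t.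
Proof.
by move=> st; apply/permP => i; apply: val_inj; rewrite /= -!permn_ord st.
Qed.

Lemma permn_ex n (f : nat -> nat) :
    (forall x, x < n -> f x < n) ->
    (forall x y, x < n -> y < n -> f x = f y -> x = y) ->
  exists s : 'S_n, forall x, x < n -> permn s x = f x.
Proof.
move=> fn f_inj; have inj_F : injective (fun i : 'I_n => Ordinal (fn i (ltn_ord i))).
  by move=> i j [] /f_inj ij; apply: val_inj; apply: ij.
exists (perm inj_F) => x xn.
by rewrite (permnE _ xn) permE.
Qed.

Lemma leq_inj_range a b c d (f : nat -> nat) : injective f ->
  (forall x, a <= x < b -> c <= f x < d) -> b - a <= d - c.
Proof.
move=> f_inj fab; rewrite -[b - a](size_iota a) -[d - c](size_iota c).
rewrite -(size_map f); apply: uniq_leq_size; first by rewrite map_inj_uniq ?iota_uniq.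
move=> _ /mapP[x + ->]; rewrite !mem_iota => hx.
by have := fab x; lia.
Qed.

Definition incr_on p n (f : nat -> nat) := forall x y, p <= x -> x < y < n -> f x < f y.

(** Upward induction gives [x <= h x], downward induction from [n] the converse. *)
Lemma incr_on_id p n h : (forall x, p <= x < n -> p <= h x < n) ->
  incr_on p n h -> forall x, p <= x < n -> h x = x.
Proof.
move=> hpn hinc.
have ge x : p <= x < n -> x <= h x.
  elim: x => [//|x IHx] xpn; case: (ltnP x p) => xp; first by have := hpn x.+1 xpn; lia.
  by have := IHx; have := hinc x x.+1 xp; lia.
have le d x : x + d = n -> p <= x < n -> h x <= x.
  elim: d x => [|d IHd] x xd xpn; first lia.
  case: (ltnP x.+1 n) => xn; last by have := hpn x xpn; lia.
  by have := IHd x.+1; have := hinc x x.+1; lia.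
by move=> x xpn; have := ge x xpn; have := le (n - x) x; lia.
Qed.

(** Both tails use the values left over by the common prefix, so [t^-1] after [s] is an increasing
    self-map of [[p, n)], hence the identity there. *)
Lemma eq_incr_on p n (s t : 'S_n) : incr_on p n (permn s) -> incr_on p n (permn t) ->
  (forall x, x < p -> permn s x = permn t x) -> s = t.
Proof.
move=> si ti st; apply: eq_permn => x xn.
case: (ltnP x p) => xp; first exact: st.
have tVs y : p <= y < n -> p <= permn t^-1%g (permn s y) < n.
  move=> ypn; rewrite !permn_lt andbC; case/andP: ypn => py -> /=; rewrite leqNgt.
  apply/negP => lt; have := st _ lt; rewrite permnKV => /permn_inj; lia.
have tmono y z : p <= y < n -> p <= z < n -> permn t y < permn t z -> y < z.
  move=> hy hz; case: (ltngtP y z) => // [zy|->]; last by rewrite ltnn.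
  by have := ti z y; lia.
suff fx : permn t^-1%g (permn s x) = x by rewrite -{2}fx permnKV.
apply: (incr_on_id (h := fun x => permn t^-1%g (permn s x)) tVs); last by rewrite xp.
move=> y z py yz; apply: tmono; [by apply: tVs; lia|by apply: tVs; lia|].
by rewrite !permnKV; apply: si.
Qed.

(** The tail lists in increasing order the values that [g] does not take on [[0, p)]. *)
Lemma incr_on_ex p n (g : nat -> nat) : p <= n ->
    (forall x, x < p -> g x < n) ->
    (forall x y, x < p -> y < p -> g x = g y -> x = y) ->
  exists2 s : 'S_n, incr_on p n (permn s) & forall x, x < p -> permn s x = g x.
Proof.
move=> pn gn g_inj.
pose c := [seq y <- iota 0 n | y \notin map g (iota 0 p)].
have sc : size c = n - p.
  have : perm_eq (iota 0 n) (c ++ map g (iota 0 p)).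
    apply: uniq_perm; rewrite ?iota_uniq // ?cat_uniq.
      rewrite filter_uniq ?iota_uniq //=; apply/andP; split.
        by apply/hasPn => y yg; rewrite mem_filter yg.
      rewrite map_inj_in_uniq ?iota_uniq // => x y; rewrite !mem_iota /= !add0n.
      by move=> xp yp; apply: g_inj.
    move=> y; rewrite mem_cat mem_filter; case: (boolP (y \in map _ _)) => //=.
      by case/mapP=> x; rewrite !mem_iota add0n /= => xp ->; rewrite add0n gn // orbT.
    by rewrite orbF mem_iota.
  by move/perm_size; rewrite size_cat size_map !size_iota; lia.
have csort : sorted ltn c.
  by apply: sorted_filter; [exact: ltn_trans | exact: iota_ltn_sorted].
have cuniq : uniq c by rewrite filter_uniq ?iota_uniq.
pose f x := if x < p then g x else nth 0 c (x - p).
have cP x : p <= x < n -> nth 0 c (x - p) \in c by move=> h; apply: mem_nth; lia.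
have cN y : y \in c -> y < n /\ forall x, x < p -> y <> g x.
  rewrite mem_filter mem_iota add0n /= => /andP[/mapP ng ->]; split=> // x xp yg.
  by apply: ng; exists x; rewrite // mem_iota.
have fn x : x < n -> f x < n.
  move=> xn; rewrite /f; case: ifP => xp; first exact: gn.
  by have [] := cN _ (cP x _) => //; lia.
have f_inj x y : x < n -> y < n -> f x = f y -> x = y.
  move=> xn yn; rewrite /f; case: ltnP => xp; case: ltnP => yp; first exact: g_inj.
  - by move=> e; have [|_ /(_ x xp)] := cN _ (cP y _); lia.
  - by move=> e; have [|_ /(_ y yp)] := cN _ (cP x _); lia.
  - by move=> /eqP; rewrite nth_uniq ?sc //; lia.
have [s sf] := permn_ex fn f_inj; exists s => [x y px xy|x xp]; last first.
  by rewrite sf ?/f ?xp //; lia.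
rewrite !sf; try lia; rewrite /f !ltnNge px (leq_trans px) /=; last lia.
by rewrite -ltnNge (sorted_ltn_nth ltn_trans 0 csort) ?inE ?sc; lia.
Qed.

(** * Point sets avoiding 132 and long increasing chains *)

(* A permutation is seen as the set of points [(u x, v x)] for [x < n], so that
   it can be exchanged with its inverse by swapping the coordinates. *)
Definition free132 n (u v : nat -> nat) := forall a b c, a < n -> b < n -> c < n ->
  u a < u b < u c -> ~~ (v a < v c < v b).

Definition ltxy (u v : nat -> nat) : rel nat := fun x y => (u x < u y) && (v x < v y).

Definition lis_le n k (u v : nat -> nat) := forall s : seq nat,
  all (fun x => x < n) s -> pairwise (ltxy u v) s -> size s <= k.

Definition good n k (u v : nat -> nat) := free132 n u v /\ lis_le n k u v.

(** An embedding that preserves both strict orders carries forbidden configurations along; this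
    passes from a permutation to its pieces. *)
Lemma good_embed m n k (u v u' v' e : nat -> nat) :
    (forall x, x < m -> e x < n) ->
    (forall x y, x < m -> y < m -> u x < u y -> u' (e x) < u' (e y)) ->
    (forall x y, x < m -> y < m -> v x < v y -> v' (e x) < v' (e y)) ->
  good n k u' v' -> good m k u v.
Proof.
move=> en eu ev [fr lis]; split=> [a b c am bm cm /andP[ab bc]|s sm us].
  apply/negP => /andP[ac cb]; apply: (negP (fr (e a) (e b) (e c) _ _ _ _)); rewrite ?en //.
    by rewrite !eu.
  by rewrite !ev.
rewrite -(size_map e); apply: lis; rewrite ?all_map.
  by apply: sub_all sm => x; apply: en.
rewrite pairwise_map; move: us; apply: (sub_in_pairwise (P := fun x => x < m)) => //.
by move=> x y xm ym /andP[uxy vxy]; rewrite /relpre /= /ltxy eu // ev.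
Qed.

(** Conversely to [good_embed], a chain contained in the image of one piece is pulled back to that
    piece and bounded there. *)
Lemma lis_le_preim m k (u v e : nat -> nat) (r : rel nat) s : lis_le m k u v ->
    (forall x, x \in s -> exists2 y, y < m & x = e y) ->
    (forall x y, x < m -> y < m -> r (e x) (e y) -> ltxy u v x y) ->
  pairwise r s -> size s <= k.
Proof.
move=> lis se re; have [s' -> sm] : exists2 s', s = map e s' & all (fun x => x < m) s'.
  elim: s se => [|x s IHs] se; first by exists [::].
  have [y ym ->] := se x (mem_head _ _).
  have [|s' -> sm] := IHs; first by move=> z zs; apply: se; rewrite inE zs orbT.
  by exists (y :: s'); rewrite //= ym.
rewrite pairwise_map size_map => rs; apply: lis => //; move: rs.
by apply: (sub_in_pairwise (P := fun x => x < m)) => // x y xm ym; apply: re.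
Qed.

Lemma incr_on_lt p N (w : 'S_N) x y : incr_on p N (permn w) -> p <= x < N -> p <= y < N ->
  (permn w x < permn w y) = (x < y).
Proof.
move=> wi hx hy; case: (ltngtP x y) => [xy|yx|->]; last by rewrite ltnn.
  by apply: wi; lia.
by apply/negbTE; rewrite -leqNgt ltnW // wi; lia.
Qed.

(** * Gluing two permutations with increasing tails around a block *)

Section Glue.
Variables (p t N s : nat) (s1 s2 : 'S_N) (b : 'S_s).
Hypotheses (leqpN : p <= N) (leqst : s <= t).

(* The points to the left of the block [p, p + t) lie above it, those below it
   lie to its right, and [f] is increasing on the points that are both above and
   to the right. The former and the latter form [s1], the last two [s2^-1]. *)
Definition glued (f : nat -> nat) :=
  [/\ forall x, x < p -> f x = p + t + permn s1 x,
      forall x, x < t -> f (p + x) = p + permn b x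
    & forall y, y < N -> f (p + t + permn s2 y) = if y < p then y else p + t + permn s1 y].

Lemma glued_ex : exists w : 'S_(p + t + N), glued (permn w).
Proof.
(* A position to the right of the block is written [p + t + permn s2 y]; its point lies below the
   block exactly when [y < p]. *)
pose f x := if x < p then p + t + permn s1 x else if x < p + t then p + permn b (x - p)
  else let y := permn s2^-1%g (x - (p + t)) in if y < p then y else p + t + permn s1 y.
have bt x : (permn b x < t) = (x < t).
  by case: (ltnP x s) => xs; [have := permn_lt b x | rewrite permn_out]; lia.
have fn x : x < p + t + N -> f x < p + t + N.
  move=> xn; rewrite /f; case: (ltnP x p) => xp; first by have := permn_lt s1 x; lia.
  case: (ltnP x (p + t)) => xpt; first by have := bt (x - p); lia.
  have /= := permn_lt s2^-1%g (x - (p + t)); case: ifP => _; first lia.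
  by have := permn_lt s1 (permn s2^-1%g (x - (p + t))); lia.
have f_inj x y : x < p + t + N -> y < p + t + N -> f x = f y -> x = y.
  move=> xn yn.
  have bx := bt (x - p); have by_ := bt (y - p).
  have s1x := permn_lt s1 x.
  rewrite /f; case: (ltnP x p) => xp; case: (ltnP y p) => yp.
  - by move=> /addnI; apply: permn_inj.
  - case: (ltnP y (p + t)) => ypt; first lia.
    by case: ltnP => [|le]; [lia | move=> /addnI e; have := permn_inj e; lia].
  - case: (ltnP x (p + t)) => xpt; first lia.
    by case: ltnP => [|le]; [lia | move=> /addnI e; have := permn_inj e; lia].
  case: (ltnP x (p + t)) => xpt; case: (ltnP y (p + t)) => ypt.
  - by move=> /addnI e; have := permn_inj e; lia.
  - by case: ltnP => le; lia.
  - by case: ltnP => le; lia.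
  case: ltnP => lx; case: ltnP => ly; try lia; first by move=> e; have := permn_inj e; lia.
  by move=> /addnI e; have := permn_inj (permn_inj e); lia.
have [w wf] := permn_ex fn f_inj; exists w; split=> [x xp|x xt|y yN].
- by rewrite wf /f ?xp //; lia.
- by rewrite wf /f ?ltn_add2l ?xt ?ltnNge ?leq_addr ?addKn //=; lia.
have := permn_lt s2 y; rewrite yN => s2y.
rewrite wf; last lia.
by rewrite /f !ltnNge -addnA leq_addr /= addnA leq_addr addKn /= permnK.
Qed.

Hypotheses (incr1 : incr_on p N (permn s1)) (incr2 : incr_on p N (permn s2)).

(** The first point of a 132 pattern or of a chain lies below and to the left of its other points.
    If it is left of the block, all points belong to [s1]; if right of it, to [s2]. If it is in the
    block, a 132 pattern stays there, since the points above and to the right increase, while a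
    chain may continue through those [N - p] points. *)
Lemma glued_good k f : glued f ->
  good (p + t + N) k id f <->
  [/\ N - p <= k, good N k id (permn s1), good N k (permn s2) id
    & good t (k - (N - p)) id (permn b)].
Proof.
move=> [fL fB fR].
have bt x : (permn b x < t) = (x < t).
  by case: (ltnP x s) => xs; [have := permn_lt b x | rewrite permn_out]; lia.
have s1N := permn_lt s1; have s2N := permn_lt s2.
(* [e] enumerates from left to right the positions of the points above the block, whose heights are
   given by [s1]; it is monotone because the tail of [s2] increases. *)
pose e x := if x < p then x else p + t + permn s2 x.
have fe x : x < N -> f (e x) = p + t + permn s1 x.
  by move=> xN; rewrite /e; case: ifP => xp; [rewrite fL | rewrite fR // xp].
have e_mono x y : x < N -> y < N -> (e x < e y) = (x < y).
  move=> xN yN; rewrite /e; case: (ltnP x p) => xp; case: (ltnP y p) => yp; try lia.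
  by rewrite ltn_add2l (incr_on_lt incr2) //; lia.
have eN x : x < N -> e x < p + t + N.
  by move=> xN; rewrite /e; have := s2N x; case: ifP; lia.
have fR_mono x y : x < N -> y < N ->
    (f (p + t + permn s2 x) < f (p + t + permn s2 y)) = (x < y).
  move=> xN yN; rewrite !fR //.
  case: (ltnP x p) => xp; case: (ltnP y p) => yp; try lia.
  by rewrite ltn_add2l (incr_on_lt incr1) //; lia.
have posR x : p + t <= x < p + t + N -> exists2 y, y < N & x = p + t + permn s2 y.
  move=> xN; exists (permn s2^-1%g (x - (p + t))); rewrite ?permn_lt ?permnKV; lia.
have posA x : x < p + t + N -> p + t <= f x -> exists2 y, y < N & x = e y.
  move=> xN fx; case: (ltnP x p) => xp; first by exists x; [lia | rewrite /e xp].
  case: (ltnP x (p + t)) => xpt.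
    by have := fB (x - p); rewrite subnKC //; have := bt (x - p); lia.
  have [|y yN xy] := posR x; first by rewrite xpt.
  by exists y => //; move: fx; rewrite /e xy fR //; case: ifP; lia.
split=> [gf|[leNpk g1 g2 [frb lisb]]].
  (* Any chain of the block can be followed by all the points above and to the right of it. *)
  have chainB l : all (fun x => x < t) l -> pairwise (ltxy id (permn b)) l ->
      size l + (N - p) <= k.
    move=> lt lp.
    have -> : size l + (N - p) = size (map (addn p) l ++ map e (iota p (N - p))).
      by rewrite size_cat !size_map size_iota.
    apply: gf.2.
      rewrite all_cat !all_map; apply/andP; split.
        by apply: sub_all lt => x /= xt; lia.
      by apply/allP => x; rewrite mem_iota /= => xN; apply: eN; lia.
    rewrite pairwise_cat !pairwise_map; apply/and3P; split.
    - apply/allrelP => _ _ /mapP[x xl ->] /mapP[y + ->]; rewrite mem_iota => yN.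
      have /= xt := allP lt x xl; have := bt x.
      rewrite /ltxy fB // fe; [rewrite /e; case: ifP; lia | lia].
    - move: lp; apply: (sub_in_pairwise (P := fun x => x < t)) => //.
      by move=> x y /= xt yt; rewrite /ltxy /= !fB // !ltn_add2l.
    rewrite -sorted_pairwise; last first.
      by move=> y x z /andP[xy fxy] /andP[yz fyz]; rewrite /= /ltxy; lia.
    apply: (sub_in_sorted (P := fun x => p <= x < N) (e := ltn)).
    - move=> x y xN yN /= xy; rewrite /ltxy e_mono ?fe ?ltn_add2l; try lia.
      by rewrite (incr_on_lt incr1) ?xy.
    - by apply/allP => x; rewrite mem_iota; lia.
    exact: iota_ltn_sorted.
  split.
  - by have := chainB [::]; apply.
  - apply: good_embed gf; first exact: eN.
      by move=> x y xN yN; rewrite /= e_mono.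
    by move=> x y xN yN; rewrite !fe // ltn_add2l.
  - apply: (good_embed (e := fun y => p + t + permn s2 y)) gf.
    + by move=> x xN; rewrite ltn_add2l s2N.
    + by move=> x y xN yN; rewrite ltn_add2l.
    + by move=> x y xN yN; rewrite fR_mono.
  split=> [|l lt lp]; last by have := chainB l lt lp; lia.
  have [] // : good t k id (permn b).
  apply: (good_embed (e := addn p)) gf => [x xt|x y xt yt|x y xt yt]; first lia.
    by rewrite ltn_add2l.
  by rewrite !fB // ltn_add2l.
have block x : p <= x < p + t -> f x = p + permn b (x - p) /\ p <= f x < p + t.
  move=> hx; have := fB (x - p); rewrite subnKC; last lia.
  by have := bt (x - p); lia.
have posC x : p + t <= x < p + t + N -> p <= f x ->
    exists2 y, p <= y < N & x = p + t + permn s2 y /\ f x = p + t + permn s1 y.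
  move=> hx fx; have [y yN xy] := posR x hx; exists y; rewrite ?xy ?fR //.
    by move: fx; rewrite xy fR //; case: ifP; lia.
  by case: ltnP => // yp; move: fx; rewrite xy fR // yp; lia.
split=> [x y z xn yn zn /andP[/= xy yz]|l ln lp].
  apply/negP => /andP[xz zy]; case: (ltnP x p) => xp.
    have fx := fL x xp.
    have [||x' xN' xe] := posA x; try lia; have [||y' yN' ye] := posA y; try lia.
    have [||z' zN' ze] := posA z; try lia.
    apply: (negP (g1.1 x' y' z' xN' yN' zN' _)).
      by rewrite /= -(e_mono x') // -(e_mono y') // -xe -ye -ze xy.
    by have := fe x' xN'; have := fe y' yN'; have := fe z' zN'; rewrite -xe -ye -ze; lia.
  case: (ltnP x (p + t)) => xpt; last first.
    have [|x' xN' xe] := posR x; first lia; have [|y' yN' ye] := posR y; first lia.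
    have [|z' zN' ze] := posR z; first lia.
    apply: (negP (g2.1 x' y' z' xN' yN' zN' _)).
      by lia.
    by rewrite /= -(fR_mono x') // -(fR_mono z') // -xe -ye -ze xz.
  have [|fx fxb] := block x; first lia.
  case: (ltnP y (p + t)) => ypt; last first.
    have [||y' yN' [ye fy]] := posC y; try lia; have [||z' zN' [ze fz]] := posC z; try lia.
    by have := incr_on_lt incr1 zN' yN'; have := incr_on_lt incr2 zN' yN'; lia.
  have [|fy fyb] := block y; first lia.
  case: (ltnP z (p + t)) => zpt; last by have [||z' _ []] := posC z; lia.
  have [|fz fzb] := block z; first lia.
  by apply: (negP (frb (x - p) (y - p) (z - p) _ _ _ _)); lia.
case: l ln lp => [//|x l] ln lp.
have xn : x < p + t + N by case/andP: ln.
have gt_x y : y \in l -> x < y /\ f x < f y.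
  by move=> yl; case/andP: lp => /allP/(_ y yl)/andP[].
have lN y : y \in x :: l -> y < p + t + N by move/(allP ln).
case: (ltnP x p) => xp.
  apply: (lis_le_preim (e := e) g1.2 _ _ lp) => [y yl|y z yN zN].
    apply: posA; first exact: lN.
    by move: yl; rewrite inE => /predU1P[->|/gt_x]; have := fL x xp; lia.
  by rewrite /ltxy e_mono // !fe // ltn_add2l.
case: (ltnP x (p + t)) => xpt; last first.
  apply: (lis_le_preim (e := fun y => p + t + permn s2 y) g2.2 _ _ lp) => [y yl|y z yN zN].
    apply: posR; have := lN y yl.
    by move: yl; rewrite inE => /predU1P[->|/gt_x]; lia.
  by rewrite /ltxy /= fR_mono // ltn_add2l.
have [|fx fxb] := block x; first lia.
have ge_x y : y \in x :: l -> p <= y /\ p <= f y.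
  by rewrite inE => /predU1P[->|/gt_x]; lia.
(* The chain is cut where it leaves the block: the first part is bounded by [lisb], the second
   injects into the tail indices [[p, N)]. *)
rewrite -(count_predC (fun y => y < p + t)) -!size_filter -(subnK leNpk).
apply: leq_add.
  apply: (lis_le_preim (e := addn p) lisb); last by apply: pairwise_filter lp.
    move=> y; rewrite mem_filter => /andP[ypt /ge_x yp].
    by exists (y - p); lia.
  by move=> y z yt zt; rewrite /ltxy !fB // !ltn_add2l.
rewrite -(size_iota p (N - p)).
rewrite -(size_map (fun y => permn s2^-1%g (y - (p + t)))); apply: uniq_leq_size.
  rewrite map_inj_in_uniq; last first.
    by move=> y z; rewrite !mem_filter => /andP[/= yp _] /andP[/= zp _] /permn_inj; lia.
  apply: filter_uniq; apply: (pairwise_uniq _ lp).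
  by move=> y; rewrite /ltxy /= ltnn.
move=> _ /mapP[y + ->]; rewrite mem_filter => /andP[/= ypt yl].
have [_ fy] := ge_x y yl; have := lN y yl => yn.
have [|//|z zN [-> _]] := posC y; first lia.
by rewrite addKn permnK mem_iota; lia.
Qed.


End Glue.

(** * Intrinsic description of the glued permutations *)

(** Two cases are used: [t = s.+1], where the block ends with the chosen fixed point, and
    [s = t = 0], where no fixed point is chosen. *)
Definition block_shape p s t n (f : nat -> nat) :=
  [/\ forall x, x < p -> p + t <= f x,
      forall x, p <= x < p + s -> p <= f x < p + s,
      forall x, p + s <= x < p + t -> f x = x
    & forall x y, p + t <= x -> x < y < n -> p + t <= f x -> p + t <= f y -> f x < f y].

Section Shape.
Variables (p t N s : nat) (w : 'S_(p + t + N)).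
Hypotheses (leqpN : p <= N) (leqst : s <= t).

Lemma glued_shape (s1 s2 : 'S_N) (b : 'S_s) :
    incr_on p N (permn s1) -> incr_on p N (permn s2) ->
  glued p t s1 s2 b (permn w) -> block_shape p s t (p + t + N) (permn w).
Proof.
move=> i1 i2 [fL fB fR]; split=> [x xp|x hx|x hx|x y hx /andP[xy yn] fx fy].
- by rewrite fL // leq_addr.
- have := fB (x - p); have := permn_lt b (x - p); rewrite subnKC; lia.
- have := fB (x - p); rewrite (permn_out b) ?subnKC; lia.
have posR z : p + t <= z < p + t + N -> p + t <= permn w z ->
    exists2 u, p <= u < N & z = p + t + permn s2 u.
  move=> hz fz; have zE : z = p + t + permn s2 (permn s2^-1%g (z - (p + t))).
    by rewrite permnKV; lia.
  have uN : permn s2^-1%g (z - (p + t)) < N by rewrite permn_lt; lia.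
  exists (permn s2^-1%g (z - (p + t))) => //.
  by move: fz; rewrite {1}zE fR //; case: ifP; lia.
have [||x' x'N xE] := posR x; try lia; have [||y' y'N yE] := posR y; try lia.
have x'y' : x' < y' by rewrite -(incr_on_lt i2) //; lia.
rewrite xE yE !fR; try lia.
by have := i1 x' y'; do 2! case: ifP; lia.
Qed.

(** The first [p] values of the permutation and of its inverse determine [s1] and [s2] through their
    increasing tails. It remains to see that these tails agree on the points above and to the right
    of the block. *)
Lemma shape_glued : block_shape p s t (p + t + N) (permn w) ->
  exists s1 s2 : 'S_N, exists b : 'S_s, [/\ incr_on p N (permn s1),
    incr_on p N (permn s2) & glued p t s1 s2 b (permn w)].
Proof.
move=> [fL fB fE fR]; have fI := @permn_inj _ w; have fn := permn_lt w.
have f'n := permn_lt w^-1%g; have f'K := permnKV w.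
have f'L y : y < p -> p + t <= permn w^-1%g y.
  move=> yp; have := f'K y; move: (permn _ y) => x xy; rewrite leqNgt; apply/negP => xpt.
  by have := fL x; have := fB x; have := fE x; lia.
have [||s1 i1 s1E] := @incr_on_ex p N (fun x => permn w x - (p + t)) leqpN.
- by move=> x xp; have := fL x; have := fn x; lia.
- by move=> x y xp yp e; apply: fI; have := fL x; have := fL y; lia.
have [||s2 i2 s2E] := @incr_on_ex p N (fun x => permn w^-1%g x - (p + t)) leqpN.
- by move=> x xp; have := f'L x; have := f'n x; lia.
- by move=> x y xp yp e; apply: (@permn_inj _ w^-1%g); have := f'L x; have := f'L y; lia.
have [||b bE] := @permn_ex s (fun x => permn w (p + x) - p).
- by move=> x xs; have := fB (p + x); lia.
- move=> x y xs ys e; apply: (@addnI p); apply: fI.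
  by have := fB (p + x); have := fB (p + y); lia.
have fb x : x < t -> permn w (p + x) = p + permn b x.
  case: (ltnP x s) => xs xt; first by rewrite bE //; have := fB (p + x); lia.
  by rewrite (permn_out b) // fE //; lia.
exists s1, s2, b; split=> //; split=> [x xp|//|y yN].
  by rewrite s1E //; have := fL x; lia.
case: (ltnP y p) => yp; first by rewrite s2E // subnKC ?f'L.
pose g z := permn w (p + t + permn s2 z).
(* Values below [p] are already taken at the indices of [s2] below [p], and the values of the block
   are taken inside the block. *)
have gge z : p <= z < N -> p + t <= g z.
  move=> hz; rewrite leqNgt; apply/negP => gpt; rewrite /g in gpt.
  case: (ltnP (g z) p) => gp.
    have : p + t + permn s2 (g z) = p + t + permn s2 z.
      by rewrite s2E // subnKC ?f'L // permnK.
    by move/addnI => /permn_inj; lia.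
  case: (ltnP (g z) (p + s)) => gs; last by have := fI _ _ (fE (g z) _); rewrite /g in gs *; lia.
  have := fb (permn b^-1%g (g z - p)); rewrite permnKV subnKC // => e.
  have bs := permn_lt b^-1%g (g z - p).
  by have := fI _ _ (e _); lia.
have gn z : z < N -> g z < p + t + N by move=> zN; rewrite fn ltn_add2l permn_lt.
(* [h] turns the [s2] index of a point above and to the right into its [s1] index. As these points
   increase, [h] is an increasing self-map of [[p, N)], hence the identity. *)
pose h z := permn s1^-1%g (g z - (p + t)).
have hN z : p <= z < N -> p <= h z < N.
  move=> hz; have ge := gge z hz; have := gn z => gzn.
  have -> : h z < N by rewrite permn_lt; lia.
  rewrite andbT leqNgt; apply/negP => hp.
  have := s1E _ hp; rewrite permnKV; have := fL _ hp => fhp e.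
  have : permn w (h z) = g z by lia.
  by move/fI; lia.
have hE : h y = y.
  apply: (@incr_on_id p N h hN); last by rewrite yp.
  move=> z u pz zu; have hz : p <= z < N by lia.
  have hu : p <= u < N by lia.
  rewrite -(incr_on_lt i1) ?hN // /h !permnKV.
  have : g z < g u; last by have := gge z hz; lia.
  apply: fR; rewrite ?gge //; first lia.
  have := permn_lt s2 u; have := i2 z u; lia.
have -> : permn s1 y = g y - (p + t) by rewrite -{1}hE permnKV.
by rewrite -/(g y) subnKC // gge // yp.
Qed.

Lemma glued_inj (s1 s2 s1' s2' : 'S_N) (b b' : 'S_s) :
    incr_on p N (permn s1) -> incr_on p N (permn s2) ->
    incr_on p N (permn s1') -> incr_on p N (permn s2') ->
    glued p t s1 s2 b (permn w) -> glued p t s1' s2' b' (permn w) ->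
  (s1, s2, b) = (s1', s2', b').
Proof.
move=> i1 i2 i1' i2' [fL fB fR] [fL' fB' fR']; congr (_, _, _).
- apply: (eq_incr_on i1 i1') => x xp; apply: (@addnI (p + t)).
  by rewrite -fL // -fL'.
- apply: (eq_incr_on i2 i2') => x xp; apply: (@addnI (p + t)); apply: (@permn_inj _ w).
  by rewrite fR ?fR' ?xp //; lia.
apply: eq_permn => x xs; apply: (@addnI p).
by rewrite -fB ?fB' //; lia.
Qed.

End Shape.

(** * Sums over the permutations of a given shape *)

(** Swapping coordinates inverts a permutation, and 132 is its own inverse. *)
Lemma good_swap n k u v : good n k u v -> good n k v u.
Proof.
move=> [fr lis]; split=> [a b c an bn cn /andP[ab bc]|l ln lp].
  apply/negP => /andP[ac cb]; apply: (negP (fr a c b an cn bn _)); first by rewrite ac.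
  by rewrite ab.
by apply: lis => //; apply: sub_pairwise lp => x y; rewrite /ltxy andbC.
Qed.

Definition tailincr k n p : {set 'S_n} :=
  [set w | `[< good n k id (permn w) /\ incr_on p n (permn w) >]].

Lemma tailincrP k n p (w : 'S_n) :
  reflect (good n k id (permn w) /\ incr_on p n (permn w)) (w \in tailincr k n p).
Proof. by rewrite inE; apply: asboolP. Qed.

(** The tail is itself a chain. *)
Lemma tailincr_leq k n p (w : 'S_n) : w \in tailincr k n p -> n - p <= k.
Proof.
move=> /tailincrP[[_ lis] wi]; rewrite -(size_iota p (n - p)); apply: lis.
  by apply/allP => x; rewrite mem_iota; lia.
apply: (sub_in_pairwise (P := fun x => p <= x < n) (r := ltn)).
- by move=> x y /= hx hy xy; rewrite /ltxy xy wi //; lia.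
- by apply/allP => x; rewrite mem_iota; lia.
by rewrite -sorted_pairwise; [exact: iota_ltn_sorted | exact: ltn_trans].
Qed.

(** Gluing is a bijection from the triples [(s1, s2, b)] onto the permutations of this shape. The
    weight depends on [b] alone, and by [good_swap] [s1] and [s2] range over the same set, whence
    the square. *)
Lemma sum_shape (A : nmodType) k n p s t N (F : 'S_n -> A) (F' : 'S_s -> A) :
    n = p + t + N -> p <= N -> s <= t ->
    (forall w (s1 s2 : 'S_N) (b : 'S_s), glued p t s1 s2 b (permn w) -> F w = F' b) ->
  (\sum_(w | `[< good n k id (permn w) /\ block_shape p s t n (permn w) >]) F w =
   (\sum_(b | `[< good t (k - (N - p)) id (permn b) >]) F' b) *+ #|tailincr k N p| ^ 2)%R.
Proof.
move=> nE; subst n => pN st FF'.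
have /boolp.choice[h hP] (x : 'S_N * 'S_N * 'S_s) :
  exists w : 'S_(p + t + N), glued p t x.1.1 x.1.2 x.2 (permn w) by apply: glued_ex.
pose A0 := [set x : 'S_N * 'S_N * 'S_s | (x.1.1 \in tailincr k N p) &&
  (x.1.2 \in tailincr k N p) && `[< good t (k - (N - p)) id (permn x.2) >]].
have hA x : x \in A0 <-> [/\ incr_on p N (permn x.1.1), incr_on p N (permn x.1.2)
    & good (p + t + N) k id (permn (h x))].
  rewrite inE; split=> [/andP[/andP[x1 x2] /asboolP gx]|[i1 i2]].
    have [g1 i1] := tailincrP _ _ _ x1; have [g2 i2] := tailincrP _ _ _ x2.
    split=> //; apply/(glued_good pN st i1 i2 k (hP x)); split=> //.
      exact: tailincr_leq x1.
    exact: good_swap.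
  move/(glued_good pN st i1 i2 k (hP x)) => [_ g1 g2 gb].
  apply/andP; split; last exact/asboolP.
  apply/andP; split; apply/tailincrP; split=> //; exact: good_swap.
have h_inj : {in A0 &, injective h}.
  move=> x y /hA[ix1 ix2 _] /hA[iy1 iy2 _] xy.
  have := hP y; rewrite -xy => hy; have := glued_inj pN st ix1 ix2 iy1 iy2 (hP x) hy.
  by case: x {xy ix1 ix2 hy} => [[? ?] ?]; case: y {iy1 iy2} => [[? ?] ?].
rewrite (eq_bigl (mem (h @: A0))) => [|w]; last first.
  apply/asboolP/imsetP => [[gw /(shape_glued pN st)[s1 [s2 [b [i1 i2 wE]]]]]|[x /hA[i1 i2 gx] ->]].
    have e : h (s1, s2, b) = w.
      have := hP (s1, s2, b); move: (h _) => /= w' [fL fB fR]; case: wE => gL gB gR.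
      apply: eq_permn => x xn; case: (ltnP x p) => xp; first by rewrite fL ?gL.
      case: (ltnP x (p + t)) => xpt.
        by have := fB (x - p); have := gB (x - p); rewrite subnKC //; lia.
      have -> : x = p + t + permn s2 (permn s2^-1%g (x - (p + t))) by rewrite permnKV; lia.
      by rewrite fR ?gR // permn_lt; lia.
    by exists (s1, s2, b) => //; apply/hA; rewrite e.
  by split=> //; apply: glued_shape (hP x).
rewrite big_imset //= (eq_bigr (fun x => F' x.2)) => [|x _]; last exact: FF' (hP x).
rewrite (eq_bigl (fun x => (x.1.1 \in tailincr k N p) && (x.1.2 \in tailincr k N p) &&
  `[< good t (k - (N - p)) id (permn x.2) >])) => [|x]; last by rewrite inE.
rewrite -(pair_big (fun y : 'S_N * 'S_N => (y.1 \in tailincr k N p) && (y.2 \in tailincr k N p))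
  (fun b => `[< good t (k - (N - p)) id (permn b) >]) (fun _ b => F' b)) /=.
by rewrite sumr_const -mulnn -cardsX; congr (_ *+ _)%R; apply: eq_card => y; rewrite inE.
Qed.

(** * Counting permutations with an increasing tail by paths in a strip *)

Section InsertMin.
Variables (k n p : nat).
Hypotheses (leqpn : p <= n) (leqnpk : n.+1 - p <= k).

Let skip x := if x < p then x else x.+1.

Let skip_mono x y : (skip x < skip y) = (x < y).
Proof. by rewrite /skip; case: (ltnP x p); case: (ltnP y p); lia. Qed.

Let skipP x : x < n.+1 -> x != p -> exists2 y, y < n & x = skip y.
Proof.
move=> xn; rewrite neq_ltn => /orP[xp|px].
  by exists x; [lia | rewrite /skip xp].
by exists x.-1; [lia | rewrite /skip ifN; lia].
Qed.

Definition inserted0 (v : 'S_n) (w : 'S_n.+1) := permn w p = 0 /\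
  forall x, x < n -> permn w (skip x) = (permn v x).+1.

Lemma inserted0_ex (v : 'S_n) : exists w, inserted0 v w.
Proof.
pose f x := if x < p then (permn v x).+1 else if x == p then 0 else (permn v x.-1).+1.
have [||w wf] := @permn_ex n.+1 f.
- move=> x xn; have := permn_lt v x; have := permn_lt v x.-1.
  by rewrite /f; case: ifP => h1; last case: ifP => h2; lia.
- move=> x y xn yn; rewrite /f.
  case: (ltnP x p) => xp; case: (ltnP y p) => yp; try case: (eqVneq x p) => xp';
    try case: (eqVneq y p) => yp' //; try lia;
    by move=> [] e; have := permn_inj e; lia.
exists w; split=> [|x xn]; first by rewrite wf /f ?ltnn ?eqxx.
rewrite wf; last by rewrite /skip; case: ifP; lia.
rewrite /f /skip; case: (ltnP x p) => xp; first by rewrite xp.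
by rewrite !ifN //=; lia.
Qed.

Lemma inserted0_onto (w : 'S_n.+1) : permn w p = 0 -> exists v, inserted0 v w.
Proof.
move=> wp; have w_gt0 x : 0 < permn w (skip x).
  rewrite lt0n -wp; apply/eqP => /permn_inj.
  by rewrite /skip; case: ifP; lia.
have skipn x : x < n -> skip x < n.+1 by rewrite /skip; case: ifP; lia.
have [||v vE] := @permn_ex n (fun x => (permn w (skip x)).-1).
- by move=> x /skipn xn; have := permn_lt w (skip x); have := w_gt0 x; lia.
- move=> x y xn yn e; have : permn w (skip x) = permn w (skip y).
    by have := w_gt0 x; have := w_gt0 y; lia.
  by move/permn_inj; have := skip_mono x y; have := skip_mono y x; lia.
by exists v; split=> // x xn; rewrite vE // prednK.
Qed.

(** The new point is the lowest one, so a 132 pattern or a chain through it starts there. The former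
    would need a descent in the tail; the latter has at most [n.+1 - p] points, all in the tail. *)
Lemma inserted0_tailincr v w : inserted0 v w ->
  (v \in tailincr k n p) = (w \in tailincr k n.+1 p).
Proof.
move=> [wp wS]; apply/tailincrP/tailincrP => [[[fr lis] vi]|[gw wi]].
  have wi : incr_on p n.+1 (permn w).
    move=> x y px /andP[xy yn]; have [|y' y'n yE] := skipP yn; first lia.
    rewrite yE wS //; case: (eqVneq x p) => [->|xp]; first by rewrite wp.
    have [|x' x'n xE] := skipP _ xp; first lia.
    have px' : p <= x' by move: xE xp px; rewrite /skip; case: ifP; lia.
    by rewrite xE wS // ltnS; apply: vi; rewrite // y'n -skip_mono -xE -yE xy.
  split=> //; split=> [x y z xn yn zn /andP[/= xy yz]|l ln lp].
    apply/negP => /andP[xz zy].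
    case: (eqVneq x p) => xp; first by have := wi y z; lia.
    case: (eqVneq y p) => yp; first by move: zy; rewrite yp wp.
    case: (eqVneq z p) => zp; first by move: xz; rewrite zp wp.
    have [x' x'n xE] := skipP xn xp; have [y' y'n yE] := skipP yn yp.
    have [z' z'n zE] := skipP zn zp.
    apply: (negP (fr x' y' z' x'n y'n z'n _)).
      by rewrite /= -(skip_mono x') -(skip_mono y') -xE -yE -zE xy.
    by move: xz zy; rewrite xE yE zE !wS //; lia.
  case: l ln lp => [//|x l] ln lp.
  have gt_x y : y \in l -> x < y /\ permn w x < permn w y.
    by move=> yl; case/andP: lp => /allP/(_ y yl)/andP[].
  case: (eqVneq x p) => xp.
    apply: leq_trans leqnpk; rewrite -(size_iota p (n.+1 - p)); apply: uniq_leq_size.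
      by apply: (pairwise_uniq _ lp) => y; rewrite /ltxy ltnn.
    move=> y yl; have := allP ln y yl; rewrite mem_iota.
    by move: yl; rewrite inE => /predU1P[->|/gt_x]; lia.
  apply: (lis_le_preim (e := skip) lis _ _ lp) => [y yl|y z yn zn].
    apply: skipP; first exact: (allP ln y yl).
    by move: yl; rewrite inE => /predU1P[->//|/gt_x[_]]; case: (eqVneq y p) => // ->; rewrite wp.
  by rewrite /ltxy skip_mono !wS.
split.
  apply: (good_embed (e := skip)) gw => [x xn|x y xn yn|x y xn yn].
  - by rewrite /skip; case: ifP; lia.
  - by rewrite /= skip_mono.
  - by rewrite !wS.
move=> x y px /andP[xy yn]; rewrite -ltnS -!wS //; last exact: ltn_trans xy yn.
by apply: wi; rewrite ?skip_mono ?xy /skip; case: ifP; lia.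
Qed.

Lemma card_tailincr_min :
  #|[set w in tailincr k n.+1 p | permn w p == 0]| = #|tailincr k n p|.
Proof.
have /boolp.choice[h hP] := inserted0_ex.
rewrite -(card_in_imset (f := h) (D := mem (tailincr k n p))) => [|v v' _ _ e].
  apply: eq_card => w; rewrite inE; apply/andP/imsetP => [[wT /eqP wp]|[v vT ->]].
    have [v vw] := inserted0_onto wp; exists v.
      by move: wT; rewrite -(inserted0_tailincr vw).
    have [hp hS] := hP v; case: vw => _ vwS.
    apply: eq_permn => x xn; case: (eqVneq x p) => [->|/(skipP xn)[y yn ->]].
      by rewrite hp wp.
    by rewrite hS ?vwS.
  by rewrite -(inserted0_tailincr (hP v)) (hP v).1.
have [_ vS] := hP v; have [_ v'S] := hP v'.
apply: eq_permn => x xn; apply: succn_inj.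
by rewrite -vS // -v'S // e.
Qed.

End InsertMin.

Lemma card_tailincr_gt k n p : k < n - p -> #|tailincr k n p| = 0.
Proof.
move=> kn; apply: eq_card0 => w; apply/negbTE/negP => /tailincr_leq; lia.
Qed.

Lemma card_tailincr00 k : #|tailincr k 0 0| = 1.
Proof.
have T w : w \in tailincr k 0 0 by apply/tailincrP; split=> [|x y _]; [split=> // -[] | lia].
rewrite (eq_card (B := [set: 'S_0])) => [|w]; last by rewrite T inE.
by rewrite cardsT card_Sn.
Qed.

(** Tails of length zero and one impose the same condition, namely none. *)
Lemma card_tailincr_out k n : #|tailincr k n.+1 n.+1| = #|tailincr k n.+1 n|.
Proof.
apply: eq_card => w; apply/tailincrP/tailincrP => -[gw wi]; split=> // x y; have := wi x y; lia.
Qed.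

(* A tail of increasing entries either starts with the least entry or can be
   extended to the left: otherwise the least entry, the entry preceding the tail
   and the first entry of the tail form 132. *)
Lemma card_tailincrS k n p : p < n -> n - p <= k ->
  #|tailincr k n.+1 p.+1| = #|tailincr k n p.+1| + #|tailincr k n.+1 p|.
Proof.
move=> pn npk; rewrite -(@card_tailincr_min k n p.+1) //.
rewrite -(cardsID [set w | permn w p.+1 == 0]) setIdE; congr (_ + _).
apply: eq_card => w; rewrite !inE; apply/andP/asboolP.
  move=> [w0 /asboolP[gw wi]]; split=> // x y px /andP[xy yn].
  have wpp : permn w p < permn w p.+1.
    rewrite ltn_neqAle leqNgt; apply/andP; split; first by apply/eqP => /permn_inj; lia.
    apply/negP => lt; pose z := permn w^-1%g 0.
    have wz : permn w z = 0 by rewrite permnKV.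
    have zn : z < n.+1 by rewrite permn_lt.
    have zNp : z != p by apply/eqP => zp; move: lt; rewrite -zp wz.
    have zNp1 : z != p.+1 by apply: contra w0 => /eqP <-; rewrite wz.
    case: (ltnP p.+1 z) => pz; first by have := wi p.+1 z; lia.
    apply: (negP (gw.1 z p p.+1 zn _ _ _)); lia.
  case: (ltnP p x) => px'; first by apply: wi; lia.
  have -> : x = p by lia.
  case: (ltnP p.+1 y) => py; last by have -> : y = p.+1 by lia.
  by apply: ltn_trans wpp _; apply: wi; lia.
move=> [gw wi]; split; first by have := wi p p.+1; lia.
by apply/asboolP; split=> // x y px; apply: wi; lia.
Qed.

(** An increasing permutation is the identity, so its first entry is the least one and can be
    deleted. *)
Lemma card_tailincr0 k n : n < k -> #|tailincr k n.+1 0| = #|tailincr k n 0|.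
Proof.
move=> nk; rewrite -(@card_tailincr_min k n 0) //.
apply: eq_card => w; rewrite [RHS]inE andb_idr // => /tailincrP[_ wi].
rewrite (@incr_on_id 0 n.+1 (permn w)) // => x xn.
by rewrite permn_lt; lia.
Qed.

(* The number of paths of length [m] with steps +1 and -1 that start at height 0,
   end at height [j], and stay between heights 0 and [k]. *)
Fixpoint strip_paths k m j : nat :=
  if m is m'.+1 then
    if k < j then 0 else
    (if j is j'.+1 then strip_paths k m' j' else 0) + strip_paths k m' j.+1
  else (j == 0).

Lemma strip_paths_gt k m j : m < j -> strip_paths k m j = 0.
Proof.
elim: m j => [|m IHm] [|j] //= mj; first by rewrite !IHm ?if_same //; lia.
Qed.

Lemma strip_paths_odd k m j : odd (m + j) -> strip_paths k m j = 0.
Proof.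
elim: m j => [|m IHm] [|j] //= mj; rewrite !IHm ?if_same //; lia.
Qed.

Lemma strip_paths_out k m j : 0 < j -> k < j -> strip_paths k m j = 0.
Proof. by case: m => [|m] /=; [case: j | move=> _ ->]. Qed.

(** Induction on [n + p], the length of the path. In [card_tailincrS] the last step goes up when the
    tail starts with the least entry, which is deleted, and down when the tail extends to the
    left. *)
Lemma card_tailincr k n p : p <= n -> #|tailincr k n p| = strip_paths k (n + p) (n - p).
Proof.
have [m] := ubnP (n + p); elim: m n p => // m IHm n p npm pn.
case: n => [|n] in npm pn *.
  by have -> : p = 0; [lia | rewrite card_tailincr00].
case: p => [|p] in npm pn *.
  rewrite addn0 subn0 /=; case: (leqP n.+1 k) => nk; last by rewrite card_tailincr_gt ?subn0.
  rewrite card_tailincr0 // IHm ?addn0 ?subn0 //; last lia.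
  (* The last step cannot go down: [n] steps do not reach height [n.+2]. *)
  by rewrite (@strip_paths_gt k n n.+2) ?addn0.
rewrite addSn /= subSS; case: (leqP (n - p) k) => npk; last by rewrite card_tailincr_gt.
case: (ltnP p n) => pn'.
  rewrite card_tailincrS // IHm ?IHm //; try lia.
  have -> : n - p = (n - p.+1).+1 by lia.
  by congr (_ + strip_paths _ _ _); lia.
(* At height 0 the last step comes from height 1; correspondingly the empty tail is replaced by a
   tail of one entry. *)
have <- : p = n by lia.
rewrite subnn /= add0n card_tailincr_out IHm //; last lia.
by rewrite subSnn addSnnS.
Qed.

(** * Existence and uniqueness of the decomposition *)

(** The [p] entries to the left of the block take distinct values above it. *)
Lemma shape_size p s t n (w : 'S_n) : p + t <= n -> block_shape p s t n (permn w) -> p + t + p <= n.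
Proof.
move=> ptn [fL _ _ _].
have : p - 0 <= n - (p + t); last lia.
by apply: (leq_inj_range (@permn_inj _ w)) => x xp; rewrite fL ?permn_lt //; lia.
Qed.

Lemma shape_leq k p s t n (w : 'S_n) : p + t <= n -> s <= t ->
  good n k id (permn w) -> block_shape p s t n (permn w) -> n - (p + t) - p <= k.
Proof.
move=> ptn st gw sw; have := shape_size ptn sw => ptpn.
have nE : n = p + t + (n - (p + t)) by lia.
move: (n - (p + t)) nE => N nE; subst n; have pN : p <= N by lia.
have [s1 [s2 [b [i1 i2 wE]]]] := shape_glued pN st sw.
by have [] := (glued_good pN st i1 i2 k wE).1 gw.
Qed.

(* The block is empty and [p] is the largest integer such that no point lies
   in [0, p) x [0, p). *)
Lemma good_shape0 k n (w : 'S_n) : good n k id (permn w) ->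
  exists2 p, p <= n & block_shape p 0 0 n (permn w).
Proof.
move=> [fr _]; have fI := @permn_inj _ w.
pose P p := (p <= n) && [forall x : 'I_p, p <= permn w x].
have P0 : exists p, P p by exists 0; apply/andP; split=> //; apply/forallP => -[].
have Pn p : P p -> p <= n by case/andP.
case: (ex_maxnP P0 Pn) => p /andP[pn /forallP fL] pmax.
exists p => //; split=> [x xp|x|x|x y]; rewrite ?addn0; try lia.
  exact: (fL (Ordinal xp)).
move=> px /andP[xy yn] fx fy.
(* Maximality of [p] yields a point in [[0, p] x [0, p]]; with a descent above and to the right it
   would form 132. *)
have [c cp fc] : exists2 c, c <= p & permn w c <= p.
  have /negP : ~~ P p.+1 by apply/negP => /pmax; rewrite ltnn.
  move=> nP; have p1n : p.+1 <= n by lia.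
  have : ~~ [forall x : 'I_p.+1, p < permn w x].
    by apply/negP => h; apply: nP; rewrite /P p1n.
  by case/forallPn => c; rewrite -leqNgt => fc; exists c; rewrite // -ltnS ltn_ord.
rewrite ltnNge; apply/negP => le; have fxy : permn w x <> permn w y by move/fI; lia.
have cx : c <> x by move=> e; rewrite e in fc; lia.
have cy : permn w c <> permn w y by move/fI; lia.
by apply: (negP (fr c x y _ _ _ _)); rewrite /=; lia.
Qed.

(** If [p < p'], the shape at [p'] puts the point at position [p] above [p] and the point of height
    [p] to the right of [p]. They form a descent, which the shape at [p] forbids. *)
Lemma shape0_inj p p' n (w : 'S_n) : p <= n -> p' <= n ->
  block_shape p 0 0 n (permn w) -> block_shape p' 0 0 n (permn w) -> p = p'.
Proof.
wlog lt : p p' / p < p'.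
  move=> wl pn p'n sp sp'; case: (ltngtP p p') => // lt; first exact: wl lt pn p'n sp sp'.
  by rewrite (wl p' p).
move=> pn p'n [_ _ _ fR] [fL _ _ _]; exfalso; rewrite !addn0 in fR fL.
have fy : permn w (permn w^-1%g p) = p by rewrite permnKV.
have yn : permn w^-1%g p < n by rewrite permn_lt; lia.
case: (ltnP (permn w^-1%g p) p') => [/fL|]; first by lia.
by have := fR p (permn w^-1%g p); have := fL p lt; lia.
Qed.

(* The block consists of the points below and to the left of the fixed point. *)
Lemma good_shape_fix k n (w : 'S_n) i : i < n -> good n k id (permn w) -> permn w i = i ->
  exists p s, p + s = i /\ block_shape p s s.+1 n (permn w).
Proof.
move=> lin [fr _] fi; have fI := @permn_inj _ w; have fn := permn_lt w.
pose P x := (x <= i) && (permn w x <= i).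
have Pi : exists x, P x by exists i; rewrite /P fi leqnn.
case: (ex_minnP Pi) => p /andP[pi fp] pmin.
have fL x : x < p -> i < permn w x.
  by move=> xp; rewrite ltnNge; apply/negP => fx; have := pmin x; rewrite /P; lia.
have fB x : p <= x < i -> permn w x < i.
  move=> hx; case: (eqVneq x p) => [->|xp].
    by rewrite ltn_neqAle fp andbT; apply/eqP; rewrite -fi => /fI; lia.
  rewrite ltnNge; apply/negP => fx.
  have fxi : permn w x <> i by rewrite -fi => /fI; lia.
  have fpi : permn w p <> i by rewrite -fi => /fI; lia.
  by apply: (negP (fr p x i _ _ _ _)); rewrite /= ?fi; lia.
(* Every value [v] with [permn w x <= v < i] occurs in [[p, i)]: further right it would form 132
   with [x] and [i], and the positions before [p] have values above [i]. Counting these values gives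
   the bound. *)
have fBp x : p <= x < i -> p <= permn w x.
  move=> hx; have fxi := fB x hx.
  suff : i - permn w x <= i - p by lia.
  apply: (leq_inj_range (@permn_inj _ w^-1%g)) => v hv.
  have := pmin (permn w^-1%g v); rewrite /P permnKV => pm.
  have ge : p <= permn w^-1%g v by rewrite leqNgt; apply/negP => /fL; rewrite permnKV; lia.
  rewrite ge /= ltnNge; apply/negP => le.
  have fv := permnKV w v; have vn : permn w^-1%g v < n by rewrite permn_lt; lia.
  have ne : permn w^-1%g v <> i by move=> e; move: fv; rewrite e fi; lia.
  have ne' : permn w x <> v by rewrite -fv => /fI; lia.
  by apply: (negP (fr x i (permn w^-1%g v) _ _ _ _)); rewrite /= ?fi ?fv; lia.
exists p, (i - p); split; first lia.
split=> [x xp|x hx|x hx|x y hx /andP[xy yn] fx fy].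
- by have := fL x xp; lia.
- by have := fBp x; have := fB x; lia.
- by have -> : x = i by lia.
rewrite ltnNge; apply/negP => le; have ne : permn w x <> permn w y by move/fI; lia.
by apply: (negP (fr i x y _ _ _ _)); rewrite /= ?fi; lia.
Qed.

(** If [p < p'], the value at [p] would lie both inside the larger block and above the common fixed
    point. *)
Lemma shape_fix_inj p s p' s' n (w : 'S_n) : p + s = p' + s' ->
  block_shape p s s.+1 n (permn w) -> block_shape p' s' s'.+1 n (permn w) -> p = p'.
Proof.
wlog lt : p s p' s' / p < p'.
  move=> wl e sp sp'; case: (ltngtP p p') => // lt; first exact: wl lt e sp sp'.
  exact/esym/(wl _ _ _ _ lt (esym e)).
move=> e [_ fB fE _] [fL _ _ _]; exfalso.
by have := fL p lt; have := fB p; have := fE p; lia.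
Qed.

(** The extension of [b] fixes [s], its last and highest point, which lengthens every chain by one
    and takes part in no 132 pattern. *)
Lemma good_fix_max s r (b : 'S_s) :
  good s.+1 r.+1 id (permn b) <-> good s r id (permn b).
Proof.
have bs : permn b s = s by rewrite permn_out.
have blt := permn_lt b; split=> [gb|[fr lis]].
  split=> [x y z xs ys zs|l ls lp].
    by apply: gb.1; lia.
  rewrite -ltnS -(size_rcons l s); apply: gb.2.
    by rewrite all_rcons /= leqnn; apply: sub_all ls => x; lia.
  rewrite pairwise_rcons lp andbT; apply/allP => x xl.
  by have := allP ls x xl; have := blt x; rewrite /ltxy bs /=; lia.
split=> [x y z xs ys zs /andP[/= xy yz]|l ls lp].
  case: (ltnP z s) => zs'; first by apply: fr; rewrite /=; lia.
  by have -> : z = s; [lia | rewrite bs; have := blt y; lia].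
rewrite -(count_predC (fun x => x < s)) -!size_filter -addn1; apply: leq_add.
  by apply: lis; [apply: filter_all | apply: pairwise_filter].
apply: (uniq_leq_size (s2 := [:: s])).
  by apply: filter_uniq; apply: (pairwise_uniq _ lp) => x; rewrite /ltxy ltnn.
move=> x; rewrite mem_filter => /andP[/= xs xl]; have := allP ls x xl.
by rewrite inE; lia.
Qed.

Lemma good_lis0 s (b : 'S_s) : ~ good s.+1 0 id (permn b).
Proof. by move=> [_ /(_ [:: s])]; rewrite /= ltnSn => /(_ isT isT). Qed.

(** Translates the patterns of the statement into point sets; a chain of more than [k] points
    contains an occurrence formed by its first [k.+1] points. *)
Lemma avoids_good n k (w : 'S_n) :
  avoids w pat132 && avoids w (pat_incr k.+1) = `[< good n k id (permn w) >].
Proof.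
have p132 (a : 'I_3) : (pat132 a : nat) = nth 0 [:: 0; 2; 1] a.
  rewrite /pat132; case: tpermP => [->|->|]; rewrite ?inordK //.
  by case: a => [[|[|[|]]] //] h /eqP + /eqP; rewrite -!val_eqE /= !inordK.
apply/andP/asboolP => [[a132 ainc]|[fr lis]].
  split=> [a b c an bn cn /andP[/= ab bc]|l ln lp].
    apply/negP => /andP[ac cb]; case/negP: a132.
    pose t := [:: Ordinal an; Ordinal bn; Ordinal cn].
    apply/existsP; exists [ffun x : 'I_3 => nth (Ordinal an) t x].
    apply/forallP => x; apply/forallP => y; rewrite !ffunE !p132 -!permn_ord.
    case: x => [[|[|[|]]] //] hx; case: y => [[|[|[|]]] //] hy /=; lia.
  rewrite leqNgt; apply/negP => lk; case/negP: ainc.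
  have nthn (x : 'I_k.+1) : nth 0 l x < n.
    by apply: (allP ln); apply: mem_nth; apply: leq_trans lk; rewrite ltn_ord.
  apply/existsP; exists [ffun x => Ordinal (nthn x)].
  have lt (x y : 'I_k.+1) : x < y -> ltxy id (permn w) (nth 0 l x) (nth 0 l y).
    move=> xy; apply: (pairwiseP 0 lp) => //; rewrite inE;
    by apply: leq_trans lk; rewrite ltn_ord.
  apply/forallP => x; apply/forallP => y; rewrite !ffunE !perm1 -!permn_ord /=.
  case: (ltngtP x y) => xy; last by rewrite xy !ltnn.
    by have /andP[-> ->] := lt _ _ xy.
  by have /andP[_ /ltnW] := lt _ _ xy; rewrite leqNgt => /negbTE ->.
split; apply/negP => /existsP[f /forallP fP].
  have fpat (x y : 'I_3) :
      ((x < y) ==> (f x < f y)) && ((w (f x) < w (f y)) == (pat132 x < pat132 y)).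
    by exact: (forallP (fP x) y).
  pose i0 : 'I_3 := inord 0; pose i1 : 'I_3 := inord 1; pose i2 : 'I_3 := inord 2.
  have v0 : (i0 : nat) = 0 by rewrite inordK.
  have v1 : (i1 : nat) = 1 by rewrite inordK.
  have v2 : (i2 : nat) = 2 by rewrite inordK.
  have := fpat i0 i1; have := fpat i1 i2; have := fpat i0 i2; have := fpat i2 i1.
  rewrite !p132 v0 v1 v2 /= => /eqP h21 /andP[_ /eqP h02] /andP[h12 _] /andP[h01 _].
  apply: (negP (fr (f i0) (f i1) (f i2) (ltn_ord _) (ltn_ord _) (ltn_ord _) _)).
    by rewrite /= h01 h12.
  by rewrite !permn_ord h02 h21.
have := lis (map (fun x : 'I_k.+1 => val (f x)) (enum 'I_k.+1)).
rewrite size_map size_enum_ord ltnn => h; apply: notF; apply: h.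
  by rewrite all_map; apply/allP => x _ /=; apply: ltn_ord.
rewrite pairwise_map.
have : pairwise (fun x y : 'I_k.+1 => x < y) (enum 'I_k.+1).
  by rewrite -(pairwise_map (fun x : 'I_k.+1 => val x) ltn) val_enum_ord
    -(sorted_pairwise ltn_trans) iota_ltn_sorted.
apply: sub_pairwise => x y xy; have /forallP/(_ y) := fP x.
by rewrite !perm1 /= /ltxy /= !permn_ord xy /= => /andP[-> /eqP->].
Qed.

Local Open Scope ring_scope.

(** * The Chebyshev quotients as generating functions of strip paths *)

Lemma zL_neq0 : zL != 0.
Proof. by rewrite tofrac_eq0; apply/eqP => /fpsP /(_ 1%N) /= /eqP; rewrite oner_eq0. Qed.

Lemma chebU_inv2z0 : chebU_inv2z 0 = 1.
Proof. by rewrite /chebU_inv2z /= rmorph1 hornerC. Qed.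

Lemma two_inv2z : 2 * (2 * zL)^-1 = zL^-1.
Proof.
rewrite invfM mulrA mulfV ?mul1r // -(rmorph_nat (@tofrac {fps rat})) tofrac_eq0.
by apply/eqP => /fpsP /(_ 0%N).
Qed.

Lemma chebU_inv2z1 : chebU_inv2z 1 = zL^-1.
Proof.
by rewrite /chebU_inv2z /= linearZ /= map_polyX hornerZ hornerX rmorph_nat two_inv2z.
Qed.

Lemma chebU_inv2zSS r : chebU_inv2z r.+2 = zL^-1 * chebU_inv2z r.+1 - chebU_inv2z r.
Proof.
rewrite /chebU_inv2z.
have -> : chebU r.+2 = 2 *: 'X * chebU r.+1 - chebU r by [].
move: (chebU r.+1) (chebU r) => p q; rewrite rmorphB rmorphM /= map_polyZ.
by rewrite map_polyX hornerD hornerN hornerM hornerZ hornerX rmorph_nat two_inv2z.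
Qed.

(** Multiplied by [zL ^+ r] it becomes a power series with constant term 1; the induction carries
    two consecutive indices. *)
Lemma chebU_inv2z_neq0 r : chebU_inv2z r != 0.
Proof.
suff [f f0 fE] : exists2 f : {fps rat}, fps_coef f 0 = 1 & zL ^+ r * chebU_inv2z r = tofrac f.
  apply: contra_eq_neq fE => ->; rewrite mulr0 eq_sym tofrac_eq0.
  by apply: contra_eq_neq f0 => ->; rewrite fps_coef0 eq_sym oner_eq0.
suff [] : (exists2 f : {fps rat}, fps_coef f 0 = 1 & zL ^+ r * chebU_inv2z r = tofrac f) /\
  (exists2 f : {fps rat}, fps_coef f 0 = 1 & zL ^+ r.+1 * chebU_inv2z r.+1 = tofrac f) by [].
elim: r => [|r [[f f0 fE] [h h0 hE]]].
  split; exists 1; rewrite ?fps_coef1 ?tofrac1 ?chebU_inv2z0 ?mulr1 //.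
  by rewrite expr1 chebU_inv2z1 mulfV ?zL_neq0.
split; first by exists h.
exists (h - fpsX rat ^+ 2 * f).
  by rewrite fps_coefB h0 expr2 -mulrA fps_coefM0 mul0r subr0.
rewrite tofracB tofracM tofracXn -fE -hE -/zL chebU_inv2zSS.
rewrite mulrBr; congr (_ - _); last by rewrite mulrA -exprD.
by rewrite [zL ^+ r.+2]exprSr mulrA mulfK // zL_neq0.
Qed.

(** This is the Chebyshev recurrence at [1/(2z)], with the term of index -1 equal to 0. *)
Lemma g_laurent_rec k l : g_laurent k l =
  zL * ((if l is l'.+1 then g_laurent k l' else 0) + g_laurent k l.+1).
Proof.
rewrite /g_laurent; case: l => [|l].
  rewrite add0r chebU_inv2z0 chebU_inv2z1 mulrA mulfV ?zL_neq0 //.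
rewrite -mulrDl chebU_inv2zSS addrC subrK mulrA mulrA mulfV ?zL_neq0 //.
by rewrite mul1r.
Qed.

Lemma g_rec k l : (l <= k)%N -> Fps (g k l) = (l == k)%:R + fpsX rat *
  ((if l is l'.+1 then Fps (g k l') else 0) + (if (l < k)%N then Fps (g k l.+1) else 0)).
Proof.
move=> lk; apply/eqP; rewrite -tofrac_eq; apply/eqP.
rewrite tofracD tofracM tofracD -/zL g_gf // g_laurent_rec.
have -> : tofrac (if l is l'.+1 then Fps (g k l') else 0) =
    if l is l'.+1 then g_laurent k l' else 0.
  by case: l lk => [|l] lk; rewrite ?tofrac0 // g_gf // ltnW.
case: (ltngtP l k) lk => // [lk _|-> _]; first by rewrite g_gf // tofrac0 add0r.
(* For [l = k] the upper neighbour [g_laurent k k.+1] is [zL^-1], which produces the constant term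
   1. *)
rewrite tofrac0 addr0 tofrac1 mulrDr addrC; congr (_ + _).
by rewrite /g_laurent mulrA mulfV // mulf_neq0 ?zL_neq0 ?chebU_inv2z_neq0.
Qed.

Lemma fps_coefXM (R : comNzRingType) (f : {fps R}) n :
  fps_coef (fpsX R * f) n = if n is n'.+1 then fps_coef f n' else 0.
Proof.
case: n => [|n]; first by rewrite fps_coefM0 mul0r.
rewrite fps_coefM (bigD1 (lift ord0 ord0)) //= mul1r subn1 big1 ?addr0 // => i.
by rewrite -val_eqE /= => /negbTE ->; rewrite mul0r.
Qed.

Lemma fps_coefCM (R : comNzRingType) (c : R) (f : {fps R}) n :
  fps_coef (fpsC c * f) n = c * fps_coef f n.
Proof.
rewrite fps_coefM big_ord_recl /= subn0 mulr1n big1 ?addr0 // => i _.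
by rewrite mulr0n mul0r.
Qed.

(** With [l = k - j] both sides obey the same recurrence: the constant term at [l = k] is the empty
    path at height 0, and [l = 0] is the upper wall of the strip. *)
Lemma g_strip_paths k m j : (j <= k)%N -> g k (k - j) m = (strip_paths k m j)%:R.
Proof.
elim: m j => [|m IHm] j jk.
  rewrite -[LHS]/(fps_coef (Fps (g k (k - j))) 0) g_rec ?leq_subr //.
  rewrite fps_coefD fps_coefXM addr0 /=.
  have -> : (k - j == k)%N = (j == 0)%N by lia.
  by case: eqP.
rewrite -[LHS]/(fps_coef (Fps (g k (k - j))) m.+1) g_rec ?leq_subr //.
rewrite fps_coefD fps_coefXM.
have -> : fps_coef ((k - j == k)%N%:R : {fps rat}) m.+1 = 0 by case: eqP.
rewrite add0r fps_coefD /= [(k < j)%N]ltnNge jk /= natrD addrC; congr (_ + _).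
  case: j jk => [|j] jk; first by rewrite subn0 ltnn.
  by rewrite ltn_subrL /= (leq_trans _ jk) //= -IHm 1?ltnW // subnSK.
case: (ltngtP j k) jk => // [lt _|-> _]; last by rewrite subnn strip_paths_out.
by rewrite -IHm // -(subnSK lt).
Qed.

(** * Weighted sums classified by shape *)

Lemma big_unique (A : nmodType) (I J : finType) (P : pred I) (Q : J -> pred I) (F : I -> A) :
    (forall i, P i -> exists2 j, Q j i & forall j', Q j' i -> j' = j) ->
  \sum_(i | P i) F i = \sum_j \sum_(i | P i && Q j i) F i.
Proof.
move=> PQ; rewrite (exchange_big_dep P) /=; last by move=> ? ? _ /andP[].
apply: eq_bigr => i Pi; have [j Qj ju] := PQ i Pi.
rewrite (big_pred1 j) // => j'; rewrite /= Pi /=.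
by apply/idP/eqP => [/ju|->].
Qed.

Definition goodp n k (w : 'S_n) := `[< good n k id (permn w) >].

(** With an empty block, [n = p + N] and [j = N - p], so [p = (n - j)./2] and [tailincr k N p] is
    counted by paths of length [n]. The values of [j] that are too large or of the wrong parity have
    no paths. *)
Lemma sum_good (A : nmodType) (a : A) n k :
  \sum_(w : 'S_n | goodp k w) a = \sum_(j < k.+1) a *+ strip_paths k n j ^ 2.
Proof.
pose Q (j : 'I_k.+1) (w : 'S_n) := [&& (j <= n)%N, ~~ odd (n - j)
  & `[< block_shape (n - j)./2 0 0 n (permn w) >]].
rewrite (big_unique (Q := Q)) => [|w /asboolP gw]; last first.
  have [p pn sp] := good_shape0 gw.
  have p2n : (p + p <= n)%N by have := shape_size _ sp; rewrite !addn0; apply.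
  have jk : (n - p - p < k.+1)%N.
    by have := shape_leq _ _ gw sp; rewrite !addn0 ltnS; apply.
  exists (Ordinal jk) => [|j /and3P[jn ev /asboolP sj]].
    have pE : ((n - (n - p - p))./2 = p)%N by lia.
    by apply/and3P; split; rewrite /= ?pE; [lia | lia | apply/asboolP].
  apply: val_inj => /=; have := shape0_inj _ pn sj sp; lia.
apply: eq_bigr => j _; have [jn|nj] := leqP j n; last first.
  rewrite strip_paths_gt // mulr0n big1 // => w; rewrite /Q.
  by rewrite leqNgt nj andbF.
case ev : (odd (n - j)).
  rewrite strip_paths_odd; last lia.
  by rewrite big1 // => w; rewrite /Q ev !andbF.
pose p := (n - j)./2.
have nE : (n = p + 0 + (n - p))%N by lia.
have pn : (p <= n - p)%N by lia.
have := sum_shape k (F := fun=> a) (F' := fun=> a) nE pn (leqnn 0) (fun _ _ _ _ _ => erefl).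
rewrite card_tailincr //.
rewrite [X in X *+ _](big_pred1 1%g) => [|b]; last first.
  have -> : b = 1%g by apply/permP => -[].
  by rewrite /= eqxx; apply/asboolP; split=> // -[] //= x l; rewrite ltn0.
have -> : (n - p + p)%N = n by lia.
have -> : (n - p - p)%N = j by lia.
move=> <-; apply: eq_bigl => w; rewrite /Q jn ev /= /goodp.
by apply/andP/asboolP => [[/asboolP ? /asboolP ?]|[? ?]] //; split; apply/asboolP.
Qed.

Definition fp_below n (w : 'S_n) i : nat := \sum_(x < i) (permn w x == x).

Lemma fp_belowT n (w : 'S_n) : fp_below w n = fp w.
Proof.
rewrite /fp_below /fp -sum1_card [RHS]big_mkcond; apply: eq_bigr => i _.
by rewrite permn_ord !inE -val_eqE; case: eqP.
Qed.

(* This is [a^f = 1 + (a - 1) (1 + a + ... + a^(f - 1))], with the powers of [a]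
   indexed by the fixed points. *)
Lemma exp_fp_below (R : nzRingType) (a : R) n (w : 'S_n) m :
  a ^+ fp_below w m =
    1 + (a - 1) * \sum_(i < m | permn w i == i) a ^+ fp_below w i.
Proof.
elim: m => [|m IHm]; first by rewrite /fp_below !big_ord0 mulr0 addr0.
rewrite big_mkcond big_ord_recr -big_mkcond /= mulrDr addrA -IHm.
rewrite [in LHS]/fp_below big_ord_recr /= -/(fp_below w m).
case: eqP => _; last by rewrite mulr0 addr0 addn0.
by rewrite addn1 exprS mulrBl mul1r addrC subrK.
Qed.

(** Entries to the left of the block lie above it, so none of them is fixed. *)
Lemma glued_fp_below p t N s n (w : 'S_n) (s1 s2 : 'S_N) (b : 'S_s) :
  (s <= t)%N -> glued p t s1 s2 b (permn w) -> fp_below w (p + s) = fp_below b s.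
Proof.
move=> st [fL fB _]; rewrite /fp_below big_split_ord /= big1 ?add0n => [|i _].
  by apply: eq_bigr => i _; rewrite fB ?eqn_add2l //; have := ltn_ord i; lia.
by rewrite fL //; have := ltn_ord i; case: eqP => //; lia.
Qed.

Lemma M_coef k n : fps_coef (M k%:Z) n = \sum_(w : 'S_n | goodp k w) 'X^(fp w).
Proof. by apply: eq_bigl => w; rewrite avoids_good. Qed.

(** The fixed point closing the block uses up one of the [k] points allowed in a chain. For [k = 0]
    no such block exists, in accordance with [M (-1) = 0]. *)
Lemma sum_good_fix_max k s :
  \sum_(b : 'S_s | `[< good s.+1 k id (permn b) >]) 'X^(fp_below b s) =
  fps_coef (M (k%:Z - 1)) s.
Proof.
case: k => [|k].
  by rewrite big1 // => b /asboolP /good_lis0.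
have -> : k.+1%:Z - 1 = k%:Z by rewrite -addn1 PoszD addrK.
rewrite M_coef; apply: eq_big => [b|b _]; last by rewrite fp_belowT.
by apply/asboolP/asboolP => /good_fix_max.
Qed.

(** The block ending at [i] has size [s.+1] with [s = n - m]. Thus [m = p + N] counts the points
    outside it, [j = N - p], and [i = p + s] with [p = (m - j)./2]. *)
Lemma sum_good_fix n k :
  \sum_(w : 'S_n.+1 | goodp k w) \sum_(i < n.+1 | permn w i == i) 'X^(fp_below w i) =
  \sum_(j < k.+1) \sum_(m < n.+1)
    fps_coef (M ((k - j)%N%:Z - 1)) (n - m) *+ strip_paths k m j ^ 2.
Proof.
rewrite pair_big_dep /= [RHS]pair_big /=.
pose Q (x : 'I_k.+1 * 'I_n.+1) (y : 'S_n.+1 * 'I_n.+1) :=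
  let: (j, m) := x in let: (w, i) := y in let p := ((m - j)./2)%N in
  [&& (j <= m)%N, ~~ odd (m - j), (p + (n - m))%N == i
    & `[< block_shape p (n - m) (n - m).+1 n.+1 (permn w) >]].
rewrite (big_unique (Q := Q)) => [|[w i] /andP[/= /asboolP gw /eqP wi]]; last first.
  have [p [s [ps sw]]] := good_shape_fix (ltn_ord i) gw wi.
  have lin := ltn_ord i; have ptn : (p + s.+1 <= n.+1)%N by lia.
  have p2n := shape_size ptn sw.
  have jk : (n.+1 - (p + s.+1) - p < k.+1)%N by rewrite ltnS (shape_leq ptn _ gw sw).
  have sn : (n - s < n.+1)%N by lia.
  exists (Ordinal jk, Ordinal sn) => [|[j m] /and4P[jm ev /eqP pi /asboolP sj]].
    have sE : (n - (n - s))%N = s by lia.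
    have pE : (((n - s) - (n.+1 - (p + s.+1) - p))./2 = p)%N by lia.
    by apply/and4P; split; rewrite /= ?pE ?sE; [lia | lia | apply/eqP | apply/asboolP].
  have := shape_fix_inj (etrans pi (esym ps)) sj sw; have mn := ltn_ord m => e.
  by congr (_, _); apply: val_inj => /=; lia.
apply: eq_bigr => -[j m] _ /=; have mn := ltn_ord m; have [jm|mj] := leqP j m; last first.
  by rewrite strip_paths_gt // mulr0n big1 // => -[w i] /andP[_ /and4P[]]; lia.
case ev : (odd (m - j)).
  rewrite strip_paths_odd; last lia.
  by rewrite mulr0n big1 // => -[w i] /andP[_ /and4P[_ oj]]; lia.
pose p := ((m - j)./2)%N; pose s := (n - m)%N.
have lin : (p + s < n.+1)%N by lia.
rewrite -sum_good_fix_max -/s.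
have nE : (n.+1 = p + s.+1 + (m - p))%N by lia.
have pm : (p <= m - p)%N by lia.
have Fb (w : 'S_n.+1) (s1 s2 : 'S_(m - p)) (b : 'S_s) : glued p s.+1 s1 s2 b (permn w) ->
    'X^(fp_below w (p + s)) = 'X^(fp_below b s) :> {poly rat}.
  by move=> wE; rewrite (glued_fp_below (leqnSn s) wE).
have := sum_shape k nE pm (leqnSn s) Fb; rewrite card_tailincr //.
have -> : (m - p + p)%N = m by lia.
have -> : (m - p - p)%N = j by lia.
move=> <-.
(* Within a class [i] must be [p + s], which the third clause of [block_shape] makes a fixed
   point. *)
transitivity (\sum_(w : 'S_n.+1 |
    `[< good n.+1 k id (permn w) /\ block_shape p s s.+1 n.+1 (permn w) >])
  \sum_(i | i == Ordinal lin) 'X^(fp_below w i) : {poly rat}); last first.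
  by apply: eq_bigr => w _; rewrite big_pred1_eq.
rewrite pair_big_dep /=; apply: eq_big => [[w i]|[w i] _] //=.
rewrite -/p [i == _]eq_sym -val_eqE /= [RHS]andbC.
apply/idP/idP => [/andP[/andP[/asboolP gw _] /andP[-> /asboolP sw]]|/andP[/eqP pi /asboolP[gw sw]]].
  by apply/asboolP.
rewrite pi eqxx /=; apply/andP; split; last exact/asboolP.
apply/andP; split; first exact/asboolP.
by case: sw => _ _ fE _; rewrite -pi fE //; lia.
Qed.

(** * Comparison of coefficients *)

Lemma fps_coef_GM k l (h : {fps {poly rat}}) n :
  fps_coef (G k l * (1 + (fpsC 'X - 1) * fpsX {poly rat} * h)) n =
  (g k l n ^+ 2)%:P + ('X - 1) * (if n is n'.+1 then
    \sum_(m < n'.+1) (g k l m ^+ 2)%:P * fps_coef h (n' - m) else 0).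
Proof.
have -> : fpsC 'X - 1 = fpsC ('X - 1) :> {fps {poly rat}}.
  by apply/fpsP => -[|i]; rewrite fps_coefB fps_coef1 //= subr0.
by rewrite mulrDr mulr1 fps_coefD -mulrA mulrCA fps_coefCM mulrCA fps_coefXM.
Qed.

Theorem theorem4p2 (k : nat) :
  M k%:Z =
    \sum_(l < k.+1)
      G k l * (1 + (fpsC 'X - 1) * fpsX {poly rat} * M (l%:Z - 1)).
Proof.
have gE j m : (j <= k)%N -> (g k (k - j) m ^+ 2)%:P = 1 *+ strip_paths k m j ^ 2 :> {poly rat}.
  by move=> jk; rewrite g_strip_paths // -natrX polyC_natr.
have revE (j : 'I_k.+1) : rev_ord j = (k - j)%N :> nat by rewrite /= subSS.
(* Reversing the sum sets [l = k - j], so that the coefficients of [G] become squared path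
   counts. *)
apply/fpsP => n; rewrite fps_coef_sum [RHS](reindex_inj rev_ord_inj) M_coef.
under [RHS]eq_bigr => j _ do rewrite fps_coef_GM revE gE -1?ltnS //.
rewrite [RHS]big_split /= -sum_good -mulr_sumr.
(* The term 1 stands for the empty set of fixed points, and the inner sum runs over the largest
   element of a nonempty one. *)
under eq_bigr => w _ do rewrite -fp_belowT exp_fp_below.
rewrite big_split /= -mulr_sumr; congr (_ + _ * _).
case: n => [|n].
  by rewrite !big1 // => w _; rewrite big_ord0.
rewrite sum_good_fix; apply: eq_bigr => j _; apply: eq_bigr => m _.
by rewrite gE -1?ltnS // mulrnAl mul1r.
Qed.
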